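(* Let $q>0$. There exists a formally $q$-normal operator $X$ on a Hilbert space $\mathcal{H}$ which has no $q$-normal extension in a possibly larger Hilbert space; that is, there is no $q$-normal operator $Y$ on a Hilbert space $\mathcal{K}$ containing $\mathcal{H}$ as a closed subspace such that $X\subseteq Y$.
   Context: A densely defined operator $X$ on a Hilbert space is called $q$-normal if $\mathcal{D}(X)=\mathcal{D}(X^* )$ and $\|X^*f\|=\sqrt q\,\|Xf\|$ for all $f\in\mathcal{D}(X)$. A densely defined operator $X$ on a Hilbert space is called formally $q$-normal if $\mathcal{D}(X)\subseteq\mathcal{D}(X^* )$ and $\|X^*f\|=\sqrt q\,\|Xf\|$ for all $f\in\mathcal{D}(X)$. $X\subseteq Y$ means $\mathcal{D}(X)\subseteq\mathcal{D}(Y)$ and $Yf=Xf$ for $f\in\mathcal{D}(X)$. *)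

(* Defs.v *)
From HB Require Import structures.
From mathcomp Require Import all_boot all_order all_algebra complex.
From mathcomp Require Import all_classical all_reals all_analysis.
Import Order.TTheory GRing.Theory Num.Theory.
Import numFieldNormedType.Exports.

Set Implicit Arguments.
Unset Strict Implicit.
Unset Printing Implicit Defensive.

Local Open Scope classical_set_scope.
Local Open Scope ring_scope.
Local Open Scope complex_scope.

(* The scalars are R[i], R a model of the real numbers; the inner product is
   linear in its first argument and conjugate-linear in its second one. The
   norm takes its values in R[i] (as nonnegative reals). *)
HB.mixin Record isHilbert (R : realType) H of CompleteNormedModule R[i] H := {
  inner : {dot H for (@Num.conj R[i])} ;
  inner_norm : forall x : H, inner x x = `|x| ^+ 2
}.

#[short(type="hilbertType")]
HB.structure Definition Hilbert (R : realType) :=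
  { H of CompleteNormedModule R[i] H & isHilbert R H }.

(* Unbounded operators: only the values on dom are meaningful. *)
Record operator (R : realType) (H : hilbertType R) := Operator {
  dom : set H ;
  op :> H -> H ;
  dom0 : dom 0 ;
  domZD : forall (a : R[i]) (f g : H), dom f -> dom g -> dom (a *: f + g) ;
  opZD : forall (a : R[i]) (f g : H), dom f -> dom g ->
    op (a *: f + g) = a *: op f + op g
}.

Definition densely_defined (R : realType) (H : hilbertType R)
  (X : operator H) : Prop := dense (dom X).

Definition is_adjoint_value (R : realType) (H : hilbertType R)
    (X : operator H) (g h : H) : Prop :=
  forall f, dom X f -> inner (X f) g = inner f h.

Definition adjoint_dom (R : realType) (H : hilbertType R)
    (X : operator H) : set H :=
  [set g | exists h, is_adjoint_value X g h].

(* Meaningful on adjoint_dom X, for X densely defined: see adjoint_eq. *)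
Definition adjoint (R : realType) (H : hilbertType R)
    (X : operator H) (g : H) : H :=
  xget 0 [set h | is_adjoint_value X g h].

Lemma adjoint_eq (R : realType) (H : hilbertType R) (X : operator H) (g h : H) :
  densely_defined X -> is_adjoint_value X g h -> adjoint X g = h.
Proof.
move=> dX gh; rewrite /adjoint; case: xgetP => [k _ /= gk|/(_ h)//].
apply/eqP/negPn/negP => kh.
pose d := k - h; have d0 : d != 0 by rewrite subr_eq0.
have nd0 : 0 < `|d| by rewrite normr_gt0.
have [] := dX (ball d `|d|).
- by exists d; exact: ballxx.
- exact: ball_open.
move=> f [+ Df]; rewrite -ball_normE /= => dist.
have fd : inner f d = 0 by rewrite linearB/= -(gk _ Df) -(gh _ Df) subrr.
move: d fd dist {d0 nd0} => d fd /lt_geF/negbT/negP; apply.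
have df : inner d f = 0 by rewrite hermC/= expr0 mul1r fd rmorph0.
rewrite -ler_sqr ?nnegrE// -!inner_norm linearBl/= !linearB/= fd df.
by rewrite !(subr0, sub0r, opprK, oppr0, add0r) lerDl inner_norm exprn_ge0.
Qed.

Definition formally_q_normal (R : realType) (H : hilbertType R) (q : R)
    (X : operator H) : Prop :=
  [/\ densely_defined X, dom X `<=` adjoint_dom X &
      forall f, dom X f -> `|adjoint X f| = (Num.sqrt q)%:C * `|X f| ].

Definition q_normal (R : realType) (H : hilbertType R) (q : R)
    (X : operator H) : Prop :=
  [/\ densely_defined X, dom X = adjoint_dom X &
      forall f, dom X f -> `|adjoint X f| = (Num.sqrt q)%:C * `|X f| ].

(* "K contains H as a closed subspace": iota is the inclusion of H in K. *)
Definition closed_subspace (R : realType) (H K : hilbertType R)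
    (iota : {linear H -> K}) : Prop :=
  (forall f g : H, inner (iota f) (iota g) = inner f g) /\
  closed (range iota).

(* X is contained in Y, H being identified with its image under iota. *)
Definition operator_le (R : realType) (H K : hilbertType R)
    (iota : {linear H -> K}) (X : operator H) (Y : operator K) : Prop :=
  forall f, dom X f -> dom Y (iota f) /\ Y (iota f) = iota (X f).

(* Main.v *)
Require Import Defs.
From HB Require Import structures.
From mathcomp Require Import all_boot all_order all_algebra complex.
From mathcomp Require Import finmap ring lra.
From mathcomp Require Import all_classical all_reals all_analysis.
From mathcomp.analysis.showcase Require Import summability.
Import Order.TTheory GRing.Theory Num.Theory.
Import numFieldNormedType.Exports.
Local Open Scope classical_set_scope.
Local Open Scope ring_scope.

Set Implicit Arguments.
Unset Strict Implicit.
Unset Printing Implicit Defensive.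

(** The proof has two independent halves; X' denotes the adjoint of X.

    Obstruction.  Let Y be a q-normal operator that extends a formally
    q-normal operator X.  Comparing norms shows that Y' extends X' on D(X)
    (extension_adjoint).  Polarizing |Y' f| = sqrt q |Y f| gives
    <Y' f, Y' g> = q <Y f, Y g>.  So if h and X' h both lie in D(X), then
    for all g in D(Y)
      q <Y g, X h> = <Y' g, X' h> = <g, Y X' h>,
    that is, X h is in the domain of Y', which is also that of Y.  Hence
    <X' g, X h> = <g, Y X h> on D(X), and this is a bounded functional of g
    (q_normal_extension_bound).  A formally q-normal operator with a vector h
    violating this bound has no q-normal extension.

    Example.  Put p = sqrt q and work in the square-summable families indexed
    by nat * int.  The weighted shift N that takes delta (m, n) to
    4^m p^n delta (m, n - 1) satisfies |N' f| = p |N f|.  It is perturbed by an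
    operator of rank one:
      X f = N f - <f, a> b,    X' f = N' f - <f, b> a,
    where a has the entries 2^-m in the column n = 1, and b the same entries
    in the column n = 0.  The perturbations are adjoint to each other, and
    they preserve the norms of N f and N' f when
      <N f, b> = |b|^2 / 2 <f, a>   and   <N' f, a> = |a|^2 / 2 <f, b>,
    because then X f is the mirror image of N f along b, and X' f that of N' f
    along a (norm_sub_half_projection).  These two linear conditions define
    D(X).  The weights 4^m outweigh the decay 2^-m of a and b, so the conditions
    are unbounded functionals of f, and the domain is still dense
    (dense_shift_dom).

    Conflict.  The conditions only concern the columns 0 and 1.  A combination
    h of delta (0, 1) and delta (1, 1) can be chosen in D(X) with <h, a> <> 0;
    X' h = N' h lives in the column 2, hence is in D(X), whereas X h has the
    component - <h, a> b.  For g = delta (k, -1) the vector X' g is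
    4^k delta (k, 0), and <X' g, X h> has modulus 2^k |<h, a>| for k > 1: it is
    unbounded (example_unbounded).

    The Hilbert space itself is built first: unordered sums over finite
    subsets, the inner product, and completeness (ell2_complete). *)

(** * Unordered sums of real families *)

Local Existing Instance totally_filter.

Section Sums.
Context {R : realType} {I : choiceType}.
Implicit Types (f g : I -> R) (F : {fset I}).

Definition psum f F : R := \sum_(i <- F) f i.
Definition abs_summable f := exists M, forall F, psum (fun i => `|f i|) F <= M.

(** Sums are unordered, as limits along the finite subsets of the index type:
    this makes them invariant under arbitrary bijective reindexings
    (total_reindex), which is how the norms of shifted families are computed. *)
Definition total f : R := lim (psum f @ totally).

Lemma psumD f g F : psum (fun i => f i + g i) F = psum f F + psum g F.
Proof. exact: big_split. Qed.

Lemma psumZ a f F : psum (fun i => a * f i) F = a * psum f F.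
Proof. by rewrite /psum mulr_sumr. Qed.

Lemma le_psum f g F : (forall i, f i <= g i) -> psum f F <= psum g F.
Proof. by move=> fg; apply: ler_sum. Qed.

Lemma psum_subset f (F G : {fset I}) : (forall i, 0 <= f i) -> (F `<=` G)%fset ->
  psum f F <= psum f G.
Proof.
move=> f0 FG; rewrite /psum.
rewrite [leRHS](big_fsetID _ (mem F))/=.
rewrite (_ : [fset x in G | x \in F]%fset = F); last first.
  by apply/fsetP => x; rewrite !inE/= andb_idl// => /(fsubsetP FG).
by rewrite lerDl sumr_ge0.
Qed.

Lemma near_totally_fsubset F : \forall G \near totally, (F `<=` G)%fset.
Proof. by exists F. Qed.

Lemma cvg_psum_ge0 f M : (forall i, 0 <= f i) -> (forall F, psum f F <= M) ->
  cvg (psum f @ totally).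
Proof.
move=> f0 fM; apply/cvg_ex; exists (sup (range (psum f))).
have hs : has_sup (range (psum f)).
  by split; [exists (psum f fset0), fset0 | exists M => _ [F _ <-]].
apply/cvgrPdist_lt => e e0.
have [_ [F0 _ <-] supF0] := sup_adherent e0 hs.
near=> F.
have FF : psum f F <= sup (range (psum f)) by apply: (ub_le_sup hs.2); exists F.
rewrite ger0_norm ?subr_ge0// ltrBlDr -ltrBlDl.
apply: lt_le_trans supF0 _; apply: psum_subset => //.
by near: F; apply: near_totally_fsubset.
Unshelve. all: by end_near. Qed.

(** f is the difference of the nonnegative families f + |f| and |f|, whose
    partial sums are monotone and bounded. *)
Lemma cvg_total f : abs_summable f -> psum f F @[F --> totally] --> total f.
Proof.
move=> [M fM].
suff : cvg (psum f @ totally) by [].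
have -> : psum f = psum (fun i => f i + `|f i|) \- psum (fun i => `|f i|).
  by apply/funext => F /=; rewrite psumD addrK.
apply: is_cvgB; last exact: cvg_psum_ge0 fM.
apply: (@cvg_psum_ge0 _ (2 * M)) => [i|F].
  by rewrite -lerBlDl sub0r -normrN ler_norm.
rewrite -[leRHS]/(2 * M) mulr2n mulrDl mul1r psumD lerD// (le_trans _ (fM F))//.
by apply: le_psum => i; exact: ler_norm.
Qed.

Lemma total_unique f l : psum f F @[F --> totally] --> l -> total f = l.
Proof. by move=> fl; apply: cvg_lim. Qed.

Lemma totalD f g : abs_summable f -> abs_summable g ->
  total (fun i => f i + g i) = total f + total g.
Proof.
move=> sf sg; apply: total_unique.
under eq_fun do rewrite psumD.
exact: cvgD (cvg_total sf) (cvg_total sg).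
Qed.

Lemma totalZ a f : abs_summable f -> total (fun i => a * f i) = a * total f.
Proof.
move=> sf; apply: total_unique.
under eq_fun do rewrite psumZ.
exact: cvgMr (cvg_total sf).
Qed.

Lemma abs_summableD f g : abs_summable f -> abs_summable g ->
  abs_summable (fun i => f i + g i).
Proof.
move=> [M fM] [N gN]; exists (M + N) => F.
apply: le_trans (lerD (fM F) (gN F)); rewrite -psumD.
by apply: le_psum => i; exact: ler_normD.
Qed.

Lemma abs_summableZ a f : abs_summable f -> abs_summable (fun i => a * f i).
Proof.
move=> [M fM]; exists (`|a| * M) => F.
under [X in psum X]eq_fun do rewrite normrM.
by rewrite psumZ ler_wpM2l.
Qed.

Lemma le_abs_summable g f : (forall i, `|f i| <= g i) -> abs_summable g ->
  abs_summable f.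
Proof.
move=> fg [M gM]; exists M => F; apply: le_trans (gM F).
by apply: le_psum => i; rewrite (le_trans (fg i))// ler_norm.
Qed.

Lemma psum_le_total f F : (forall i, 0 <= f i) -> abs_summable f ->
  psum f F <= total f.
Proof.
move=> f0 /cvg_total fl; apply: limr_ge; first by apply/cvg_ex; exists (total f).
by near=> G; apply: psum_subset => //; near: G; apply: near_totally_fsubset.
Unshelve. all: by end_near. Qed.

Lemma total_le f M : abs_summable f -> (forall F, psum f F <= M) ->
  total f <= M.
Proof.
move=> /cvg_total fl fM; apply: limr_le; first by apply/cvg_ex; exists (total f).
by near=> G; apply: fM.
Unshelve. all: by end_near. Qed.

Lemma total_ge0 f : (forall i, 0 <= f i) -> abs_summable f -> 0 <= total f.
Proof.
by move=> f0 sf; have := psum_le_total fset0 f0 sf; rewrite /psum big_seq_fset0.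
Qed.

Lemma total_eq0 f : (forall i, 0 <= f i) -> abs_summable f -> total f = 0 ->
  forall i, f i = 0.
Proof.
move=> f0 sf f_eq0 i; apply/eqP; rewrite eq_le f0 andbT -f_eq0.
by have := psum_le_total [fset i]%fset f0 sf; rewrite /psum big_seq_fset1.
Qed.

Lemma total_single f i : (forall j, j != i -> f j = 0) -> total f = f i.
Proof.
move=> fi; apply: total_unique; apply: cvg_near_cst; near=> F.
have : ([fset i] `<=` F)%fset by near: F; apply: near_totally_fsubset.
rewrite fsub1set /psum => iF.
by rewrite (big_fsetD1 i)//= big1_seq ?addr0// => j /andP[_]; rewrite !inE => /andP[/fi].
Unshelve. all: by end_near. Qed.

Lemma psum_reindex f (s t : I -> I) F : cancel s t ->
  psum (f \o s) F = psum f [fset s i | i in F]%fset.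
Proof.
move=> st; rewrite /psum big_imfset//= => i j _ _; exact: (can_inj st).
Qed.

(** Taking images under s maps the filter of finite sets into itself: a finite
    set contains F once its preimage contains the image of F under t. *)
Lemma total_reindex f (s t : I -> I) : cancel s t -> cancel t s ->
  abs_summable f -> total (f \o s) = total f.
Proof.
move=> st ts sf; apply: total_unique.
under eq_fun do rewrite (psum_reindex _ _ st).
apply: (@cvg_comp _ _ _ (fun F => [fset s i | i in F]%fset) (psum f) _ totally);
  last exact: cvg_total.
move=> A [F _ FA]; exists [fset t i | i in F]%fset => //= G /= FG.
apply: FA => /=; apply/fsubsetP => i iF; apply/imfsetP; exists (t i) => //=.
by apply: (fsubsetP FG); apply/imfsetP; exists i.
Qed.

End Sums.

(** * Square-summable families *)

Section Ell2.
Context {R : realType} {I : choiceType}.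
Local Notation C := R[i].

Definition csq (z : C) : R := complex.Re z ^+ 2 + complex.Im z ^+ 2.

Definition square_summable (x : I -> C^o) : bool :=
  `[< exists M, forall F, psum (fun i => csq (x i)) F <= M >].

Lemma csq_ge0 z : 0 <= csq z.
Proof. by rewrite addr_ge0// sqr_ge0. Qed.

Lemma csqD_le z w : csq (z + w) <= 2 * csq z + 2 * csq w.
Proof.
case: z w => [a b] [c d]; rewrite /csq/=.
have := sqr_ge0 (a - c); have := sqr_ge0 (b - d); nra.
Qed.

Lemma csqM z w : csq (z * w) = csq z * csq w.
Proof. by case: z w => [a b] [c d]; rewrite /csq/=; ring. Qed.

Lemma square_summable_submod : submod_closed square_summable.
Proof.
split=> [|a x y /asboolP[M xM] /asboolP[N yN]]; apply/asboolP.
  exists 0 => F; rewrite /psum big1// => i _.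
  by rewrite /csq/= !expr0n addr0.
exists (2 * (csq a * M) + 2 * N) => F.
apply: (@le_trans _ _ (psum (fun i => 2 * (csq a * csq (x i)) + 2 * csq (y i)) F)).
  by apply: le_psum => i; rewrite -csqM; apply: csqD_le.
by rewrite psumD !psumZ lerD// ler_wpM2l// ler_wpM2l// csq_ge0.
Qed.

HB.instance Definition _ :=
  GRing.isSubmodClosed.Build C (I -> C^o) square_summable square_summable_submod.

(** Families with values in C^o, the scalars seen as a module over themselves,
    so that the module structure comes from that of functions. *)
Record ell2 := Ell2 { coord :> I -> C^o ; coordP : coord \in square_summable }.
HB.instance Definition _ := [isSub for coord].
HB.instance Definition _ := [Choice of ell2 by <:].
HB.instance Definition _ := [SubChoice_isSubLmodule of ell2 by <:].

Implicit Types x y : ell2.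
Lemma ell2P x y : (forall i, x i = y i) -> x = y.
Proof. by move=> xy; apply/val_inj/funext. Qed.
Lemma coordD x y i : (x + y) i = x i + y i. Proof. by []. Qed.
Lemma coordZ a x i : (a *: x) i = a * x i. Proof. by []. Qed.
Lemma coordN x i : (- x) i = - x i. Proof. by []. Qed.
Lemma coord0 i : (0 : ell2) i = 0. Proof. by []. Qed.
End Ell2.

(** * The inner product of square-summable families *)

(** Expand the nonnegative form at <v, v> u - <u, v> v and divide by <v, v>. *)
Lemma dot_CauchySchwarz (C : numClosedFieldType) (U : lmodType C)
    (f : {dot U for @Num.conj C}) (u v : U) :
  `|f u v| ^+ 2 <= f u u * f v v.
Proof.
have [->|v0] := eqVneq v 0; first by rewrite !raddf0 normr0 expr0n mulr0.
have fv : 0 < f v v by rewrite neq0_dnorm_gt0.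
have E : f (f v v *: u) (f u v *: v) = f v v * ((f u v)^* * f u v).
  by rewrite linearZl_LR linearZr_LR.
have := dnorm_ge0 f (f v v *: u - f u v *: v).
rewrite dnormB !dnormZ E !rmorphM/= conjCK (geC0_conj (ltW fv)) (ger0_norm (ltW fv)).
rewrite [(f u v)^* * f u v]mulrC normCK.
set n := f u v * (f u v)^*; set a := f v v in fv *; set b := f u u.
rewrite (_ : _ + _ - _ = a * (b * a - n)); last by rewrite /n; ring.
by rewrite pmulr_rge0// subr_ge0.
Qed.

Section Inner.
Context {R : realType} {I : choiceType}.
Local Notation C := R[i].
Local Notation H := (@ell2 R I).
Implicit Types (f g : I -> C) (x y : H).

Definition csummable f :=
  abs_summable (fun i => complex.Re (f i)) /\ abs_summable (fun i => complex.Im (f i)).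

Definition ctotal f : C :=
  (total (fun i => complex.Re (f i)) +i* total (fun i => complex.Im (f i)))%C.

Lemma ctotalD f g : csummable f -> csummable g ->
  ctotal (fun i => f i + g i) = ctotal f + ctotal g.
Proof.
move=> [rf jf] [rg jg]; rewrite /ctotal.
apply/eqP; rewrite eq_complex/=; apply/andP; split; apply/eqP; rewrite -totalD//.
  by congr total; apply/funext => i; case: (f i) (g i) => [? ?] [].
by congr total; apply/funext => i; case: (f i) (g i) => [? ?] [].
Qed.

Lemma ctotalZ a f : csummable f -> ctotal (fun i => a * f i) = a * ctotal f.
Proof.
move=> [rf jf]; case: a => a b; rewrite /ctotal.
apply/eqP; rewrite eq_complex/= -mulNr -!totalZ//; apply/andP; split; apply/eqP.
  rewrite -totalD; [|exact: abs_summableZ..].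
  by congr total; apply/funext => i; case: (f i) => ? ?/=; rewrite mulNr.
rewrite -totalD; [|exact: abs_summableZ..].
by congr total; apply/funext => i; case: (f i) => ? ?/=.
Qed.

Lemma ctotal_conj f : csummable f -> ctotal (fun i => (f i)^*) = (ctotal f)^*.
Proof.
move=> [rf jf]; apply/eqP; rewrite eq_complex/=; apply/andP; split; apply/eqP.
  by congr total; apply/funext => i; case: (f i) => ? ?.
rewrite -mulN1r -totalZ//.
by congr total; apply/funext => i; case: (f i) => ? ?/=; rewrite mulN1r.
Qed.

Lemma ctotal_single f i : (forall j, j != i -> f j = 0) -> ctotal f = f i.
Proof.
move=> fi; rewrite /ctotal !(@total_single _ _ _ i) => [|j /fi->//|j /fi->//].
by case: (f i).
Qed.

Lemma ctotal_reindex f (s t : I -> I) : cancel s t -> cancel t s ->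
  csummable f -> ctotal (f \o s) = ctotal f.
Proof.
by move=> st ts [rf jf]; congr (_ +i* _)%C; rewrite -[RHS](@total_reindex _ _ _ s t).
Qed.

Lemma abs_summable_csq x : abs_summable (fun i => csq (x i)).
Proof.
have /asboolP[M xM] := coordP x; exists M => F.
by under [X in psum X]eq_fun do rewrite ger0_norm ?csq_ge0//.
Qed.

(** The real and imaginary parts of x y^* are dominated by |x|^2 + |y|^2. *)
Lemma csummable_dot x y : csummable (fun i => x i * (y i)^*).
Proof.
have sxy := abs_summableD (abs_summable_csq x) (abs_summable_csq y).
split; apply: le_abs_summable sxy => i; rewrite /csq.
  case: (x i) (y i) => [a b] [c d]/=; rewrite ler_norml.
  have := sqr_ge0 (a + c); have := sqr_ge0 (b + d).
  have := sqr_ge0 (a - c); have := sqr_ge0 (b - d).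
  by move=> ? ? ? ?; apply/andP; split; nra.
case: (x i) (y i) => [a b] [c d]/=; rewrite ler_norml.
have := sqr_ge0 (a + d); have := sqr_ge0 (b + c).
have := sqr_ge0 (a - d); have := sqr_ge0 (b - c).
by move=> ? ? ? ?; apply/andP; split; nra.
Qed.

Definition ell2_dot x y : C := ctotal (fun i => x i * (y i)^*).

Lemma ell2_dotC x y : ell2_dot x y = (-1) ^+ false * (ell2_dot y x)^*.
Proof.
rewrite expr0 mul1r -ctotal_conj; last exact: csummable_dot.
by congr ctotal; apply/funext => i; rewrite rmorphM/= conjCK mulrC.
Qed.

Lemma ell2_dot_linear_l y : GRing.linear_for *%R (ell2_dot^~ y).
Proof.
move=> a x z; rewrite /ell2_dot.
rewrite (_ : (fun i => _) = fun i => (a *: x) i * (y i)^* + z i * (y i)^*); last first.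
  by apply/funext => i; rewrite coordD mulrDl.
rewrite (ctotalD (csummable_dot _ _) (csummable_dot _ _)); congr (_ + _).
rewrite -(ctotalZ _ (csummable_dot _ _)).
by congr ctotal; apply/funext => i; rewrite coordZ mulrA.
Qed.

Lemma ell2_dotxx x : ell2_dot x x = (total (fun i => csq (x i)))%:C%C.
Proof.
apply/eqP; rewrite eq_complex/=; apply/andP; split; apply/eqP.
  by congr total; apply/funext => i; case: (x i) => a b; rewrite /csq/=; ring.
rewrite (_ : (fun i => _) = fun i => 0 * csq (x i)).
  by rewrite totalZ ?mul0r//; exact: abs_summable_csq.
by apply/funext => i; case: (x i) => a b; rewrite mul0r/=; ring.
Qed.

Lemma ell2_dot_gt0 x : x != 0 -> 0 < ell2_dot x x.
Proof.
move=> x0; rewrite ell2_dotxx ltcR lt_neqAle eq_sym.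
rewrite (total_ge0 (fun i => csq_ge0 (x i)) (abs_summable_csq x)) andbT; apply: contra x0 => /eqP x0.
apply/eqP/val_inj/funext => i /=.
have /(_ i)/eqP := total_eq0 (fun i => csq_ge0 (x i)) (abs_summable_csq x) x0.
rewrite /csq paddr_eq0 ?sqr_ge0// !sqrf_eq0 => /andP[/eqP a0 /eqP b0].
by apply/eqP; rewrite eq_complex a0 b0 !eqxx.
Qed.

Lemma ell2_dot_linear_r x : GRing.linear_for (@Num.conj C \; *%R) (ell2_dot x).
Proof.
move=> a y z; rewrite ell2_dotC expr0 mul1r ell2_dot_linear_l rmorphD rmorphM/=.
by rewrite [ell2_dot x y]ell2_dotC [ell2_dot x z]ell2_dotC !expr0 !mul1r.
Qed.

HB.instance Definition _ := bilinear_isBilinear.Build C H H C *%R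
  (@Num.conj C \; *%R) ell2_dot (ell2_dot_linear_l, ell2_dot_linear_r).
HB.instance Definition _ :=
  isHermitianSesquilinear.Build C H false (@Num.conj C) ell2_dot ell2_dotC.
HB.instance Definition _ := isDotProduct.Build C H ell2_dot ell2_dot_gt0.

End Inner.

(** * Completeness of the space of square-summable families *)

Section Ell2Hilbert.
Context {R : realType} {I : choiceType}.
Local Notation C := R[i].
Local Notation H := (@ell2 R I).
Implicit Types (x y : H).

Definition ell2_rnorm x : R := Num.sqrt (total (fun i => csq (x i))).

Lemma sqr_ell2_rnorm x : ell2_rnorm x ^+ 2 = total (fun i => csq (x i)).
Proof.
by rewrite sqr_sqrtr// (total_ge0 (fun i => csq_ge0 _) (abs_summable_csq x)).
Qed.

Lemma ell2_dot_rnorm x : ell2_dot x x = ((ell2_rnorm x)%:C ^+ 2)%C.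
Proof. by rewrite ell2_dotxx -rmorphXn/= sqr_ell2_rnorm. Qed.

Lemma ell2_rnorm_ge0 x : 0 <= ((ell2_rnorm x)%:C)%C.
Proof. by rewrite ler0c sqrtr_ge0. Qed.

Lemma ell2_normD x y :
  ((ell2_rnorm (x + y))%:C <= (ell2_rnorm x)%:C + (ell2_rnorm y)%:C)%C.
Proof.
rewrite -(@ler_pXn2r _ 2)// ?nnegrE ?addr_ge0 ?ell2_rnorm_ge0//.
rewrite -ell2_dot_rnorm [leLHS](dnormD (@ell2_dot R I))/= !ell2_dot_rnorm sqrrD.
set a := (ell2_rnorm x)%:C%C; set b := (ell2_rnorm y)%:C%C.
rewrite [leRHS]addrAC lerD2l.
set d := ell2_dot x y.
have dab : `|d| <= a * b.
  rewrite -(@ler_pXn2r _ 2)// ?nnegrE ?mulr_ge0 ?ell2_rnorm_ge0//.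
  by rewrite exprMn -!ell2_dot_rnorm (dot_CauchySchwarz (@ell2_dot R I)).
apply: (@le_trans _ _ (`|d| + `|d|)); last by rewrite mulr2n lerD.
apply: le_trans (_ : `|d + d^*| <= _); last by rewrite (le_trans (ler_normD _ _))// norm_conjC.
by apply: real_ler_norm; rewrite CrealE rmorphD/= conjCK addrC.
Qed.

Lemma ell2_normZ (a : C) x :
  ((ell2_rnorm (a *: x))%:C = `|a| * (ell2_rnorm x)%:C)%C.
Proof.
apply/eqP; rewrite -(@eqrXn2 _ 2)// ?mulr_ge0 ?ell2_rnorm_ge0//.
by rewrite exprMn -!ell2_dot_rnorm; apply/eqP; exact: (dnormZ (@ell2_dot R I)).
Qed.

Lemma ell2_norm_eq0 x : ((ell2_rnorm x)%:C)%C = 0 -> x = 0.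
Proof.
move=> x0; apply/eqP; rewrite -(dnorm_eq0 (@ell2_dot R I)).
by rewrite -[_ x x]/(ell2_dot x x) ell2_dot_rnorm x0 expr0n.
Qed.

HB.instance Definition _ :=
  Lmodule_isNormed.Build C H ell2_normD ell2_normZ ell2_norm_eq0.

Lemma ell2_normE x : `|x| = (ell2_rnorm x)%:C%C. Proof. by []. Qed.

Lemma csq_coord_le x i : csq (x i) <= ell2_rnorm x ^+ 2.
Proof.
rewrite sqr_ell2_rnorm.
have := psum_le_total [fset i]%fset (fun i => csq_ge0 (x i)) (abs_summable_csq x).
by rewrite /psum big_seq_fset1.
Qed.

Lemma Re_coord_le x i : `|complex.Re (x i)| <= ell2_rnorm x.
Proof.
rewrite -ler_sqr ?nnegrE ?sqrtr_ge0// real_normK ?num_real//.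
by apply: le_trans (csq_coord_le x i); rewrite lerDl sqr_ge0.
Qed.

Lemma Im_coord_le x i : `|complex.Im (x i)| <= ell2_rnorm x.
Proof.
rewrite -ler_sqr ?nnegrE ?sqrtr_ge0// real_normK ?num_real//.
by apply: le_trans (csq_coord_le x i); rewrite lerDr sqr_ge0.
Qed.

Lemma cauchy_ell2 (F : set_system H) : ProperFilter F -> cauchy F ->
  forall e : R, 0 < e -> exists2 A, F A & forall x y, A x -> A y -> ell2_rnorm (x - y) < e.
Proof.
move=> FF /cauchy_ballP Fc e e0.
have e0' : 0 < (e%:C)%C by rewrite ltcR.
have [[A B] [FA FB] AB] := Fc _ e0'.
exists (A `&` B); first exact: filterI.
move=> x y [Ax _] [_ By]; have /= := AB (x, y) (conj Ax By).
by rewrite -ball_normE /= ell2_normE ltcR.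
Qed.

Lemma cvg_coord (g : H -> R) (F : set_system H) : ProperFilter F -> cauchy F ->
  (forall x y, `|g x - g y| <= ell2_rnorm (x - y)) -> cvg (g @ F).
Proof.
move=> FF Fc gle; apply: cauchy_cvg; apply/cauchy_ballP => e e0.
have [A FA Ae] := cauchy_ell2 _ Fc e0.
have FgA : F (g @^-1` (g @` A)) by apply: filterS FA => x Ax; exists x.
exists (g @` A, g @` A) => //.
move=> [_ _] [[x Ax <-] [y Ay <-]] /=.
by rewrite -ball_normE /=; apply: le_lt_trans (gle _ _) (Ae _ _ Ax Ay).
Qed.

(** The coordinates of a Cauchy filter converge, because they are Lipschitz.
    If x is e-close to a whole set of the filter, then letting the other point
    tend to the coordinatewise limit z inside a finite partial sum bounds all
    partial sums of |x - z|^2 by e^2.  This shows at once that z is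
    square-summable and that the filter converges to it in norm. *)
Lemma ell2_complete (F : set_system H) : ProperFilter F -> cauchy F -> cvg F.
Proof.
move=> FF Fc.
pose re i (x : H) : R := complex.Re (x i); pose im i (x : H) : R := complex.Im (x i).
have cre i : re i x @[x --> F] --> lim (re i @ F).
  apply: cvg_coord => // x y; rewrite (_ : _ - _ = re i (x - y)) ?Re_coord_le//.
  by rewrite /re coordD coordN; case: (x i) (y i) => [? ?] [].
have cim i : im i x @[x --> F] --> lim (im i @ F).
  apply: cvg_coord => // x y; rewrite (_ : _ - _ = im i (x - y)) ?Im_coord_le//.
  by rewrite /im coordD coordN; case: (x i) (y i) => [? ?] [].
pose z (i : I) : C^o := (lim (re i @ F) +i* lim (im i @ F))%C.
have near_z (e : R) (A : set H) (x : H) G : F A ->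
    (forall y, A y -> ell2_rnorm (x - y) < e) ->
    psum (fun i => csq (x i - z i)) G <= e ^+ 2.
  move=> FA Ae.
  pose h i (y : H) : R := csq (x i - y i).
  have ci i : h i @ F --> csq (x i - z i).
    have -> : h i = fun y : H =>
        (re i x - re i y) * (re i x - re i y) + (im i x - im i y) * (im i x - im i y).
      by apply/funext => y; rewrite /h /csq /re /im; case: (x i) (y i) => [? ?] [].
    have -> : csq (x i - z i) =
        (re i x - lim (re i @ F)) * (re i x - lim (re i @ F)) +
        (im i x - lim (im i @ F)) * (im i x - lim (im i @ F)).
      by rewrite /csq /z /re /im; case: (x i) => ? ?.
    by apply: cvgD; apply: cvgM; apply: cvgB => //; exact: cvg_cst.
  have cG : (fun y => psum (h^~ y) G) @ F -->
            psum (fun i => csq (x i - z i)) G.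
    rewrite /psum; exact: (@cvg_big R I +%R 0 xpredT (@add_continuous R) H F G h (fun i => csq (x i - z i)) _ (fun i _ => ci i)).
  rewrite -(cvg_lim _ cG)//; apply: limr_le; first by apply/cvg_ex; eexists; exact: cG.
  apply: filterS FA => y Ay.
  have := psum_le_total G (fun i => csq_ge0 ((x - y) i)) (abs_summable_csq (x - y)).
  rewrite -sqr_ell2_rnorm => /le_trans; apply.
  by rewrite ler_sqr ?nnegrE ?sqrtr_ge0 ?(ltW (Ae _ Ay))// (le_trans _ (ltW (Ae _ Ay)))// sqrtr_ge0.
have zdiff (x : H) (e : R) (A : set H) : F A -> (forall y, A y -> ell2_rnorm (x - y) < e) ->
    ((fun i => x i - z i) : I -> C^o) \in square_summable.
  by move=> FA Ae; apply/asboolP; exists (e ^+ 2) => G; apply: near_z FA Ae.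
have [A0 FA0 A01] := cauchy_ell2 _ Fc ltr01.
have [x0 Ax0] := filter_ex FA0.
have zP : z \in square_summable.
  rewrite (_ : z = (x0 : I -> C^o) - (fun i => x0 i - z i)).
    by rewrite rpredB ?coordP// (zdiff _ _ _ FA0 (fun y => A01 _ y Ax0)).
  by apply/funext => i; rewrite !fctE opprB addrC subrK.
apply/cvg_ex; exists (Ell2 zP); apply/cvgrPdist_le => e e0.
have [r r0 re_] : exists2 r : R, 0 < r & e = (r%:C)%C.
  by case: e e0 => a b; rewrite ltcE/= => /andP[/eqP-> a0]; exists a.
have [A FA Ae] := cauchy_ell2 _ Fc r0.
apply: filterS (FA) => x Ax; rewrite distrC ell2_normE re_ lecR.
rewrite -ler_sqr ?nnegrE ?sqrtr_ge0 ?(ltW r0)// sqr_ell2_rnorm.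
by apply: total_le => [|G]; [exact: (abs_summable_csq (x - _))|apply: near_z FA (fun y => Ae _ y Ax)].
Qed.

HB.instance Definition _ := Uniform_isComplete.Build H ell2_complete.

Lemma ell2_inner_norm x : ell2_dot x x = `|x| ^+ 2.
Proof. by rewrite ell2_dot_rnorm. Qed.

HB.instance Definition _ := isHilbert.Build R H ell2_inner_norm.

Lemma ell2_innerE x y : inner x y = ctotal (fun i => x i * (y i)^*).
Proof. by []. Qed.
End Ell2Hilbert.

(** * An obstruction to q-normal extensions *)

Section HilbertFacts.
Context {R : realType}.
Local Notation C := R[i].

Lemma inner_CauchySchwarz (H : hilbertType R) (x y : H) :
  `|inner x y| <= `|x| * `|y|.
Proof.
rewrite -(@ler_pXn2r _ 2)// ?nnegrE ?mulr_ge0//.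
by rewrite exprMn -!inner_norm dot_CauchySchwarz.
Qed.

Lemma innerC (H : hilbertType R) (x y : H) : inner x y = (inner y x)^*.
Proof. by rewrite hermC/= expr0 mul1r. Qed.

Lemma innerPl (H : hilbertType R) a (x y z : H) :
  inner (a *: x + y) z = a * inner x z + inner y z.
Proof. by rewrite linearPl. Qed.

Lemma innerPr (H : hilbertType R) a (x y z : H) :
  inner z (a *: x + y) = a^* * inner z x + inner z y.
Proof. by rewrite linearPr. Qed.

Lemma innerBl (H : hilbertType R) (x y z : H) :
  inner (x - y) z = inner x z - inner y z.
Proof. by rewrite linearBl. Qed.

Lemma innerBr (H : hilbertType R) (x y z : H) :
  inner z (x - y) = inner z x - inner z y.
Proof. by rewrite linearBr. Qed.

Lemma innerZr (H : hilbertType R) a (x z : H) :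
  inner z (a *: x) = a^* * inner z x.
Proof. by rewrite linearZr_LR. Qed.

Lemma innerZl (H : hilbertType R) a (x z : H) :
  inner (a *: x) z = a * inner x z.
Proof. by rewrite linearZl_LR. Qed.

(** For c = 2 <x, y> / |y|^2 the vector x - c y is the mirror image of x in the
    hyperplane orthogonal to y. *)
Lemma norm_sub_half_projection (H : hilbertType R) (x y : H) (c : R[i]) :
  inner x y = `|y| ^+ 2 / 2 * c -> `|x - c *: y| = `|x|.
Proof.
move=> xy; apply/eqP; rewrite -(@eqrXn2 _ 2)// -!inner_norm.
rewrite innerBl !innerBr !innerZl !innerZr (innerC y) xy inner_norm.
have y2 : (`|y| ^+ 2 / 2)^* = `|y| ^+ 2 / 2 :> R[i].
  by rewrite geC0_conj// divr_ge0// exprn_ge0.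
rewrite rmorphM/= y2 (inner_norm y).
set n := `|y| ^+ 2 / 2; have -> : `|y| ^+ 2 = n + n by rewrite -splitr.
by apply/eqP; ring.
Qed.

Lemma isometry_norm (H K : hilbertType R) (iota : H -> K) :
  (forall f g, inner (iota f) (iota g) = inner f g) ->
  forall x, `|iota x| = `|x|.
Proof.
by move=> iso x; apply/eqP; rewrite -(@eqrXn2 _ 2)// -!inner_norm iso.
Qed.

(** Both sides are continuous in g, by the Cauchy-Schwarz inequality. *)
Lemma dense_inner_eq (H K : hilbertType R) (iota : {linear H -> K}) (D : set H)
    (u : K) (v : H) :
  (forall f g, inner (iota f) (iota g) = inner f g) -> dense D ->
  (forall g, D g -> inner (iota g) u = inner g v) ->
  forall g, inner (iota g) u = inner g v.
Proof.
move=> iso dD uv g; apply/eqP; rewrite -subr_eq0 -normr_eq0.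
apply/negPn/negP => c0; set c := `|_| in c0.
have {}c0 : 0 < c by rewrite lt_def c0 normr_ge0.
pose s := `|u| + `|v| + 1.
have s0 : 0 < s by rewrite ltr_wpDl// addr_ge0.
have [] := dD (ball g (c / s)).
- by exists g; apply: ballxx; rewrite divr_gt0.
- exact: ball_open.
move=> f [+ Df]; rewrite -ball_normE/= => gf.
suff : c < c by rewrite ltxx.
have {1}-> : c = `|inner (iota (g - f)) u - inner (g - f) v|.
  by rewrite /c raddfB/= !linearBl/= (uv _ Df); congr `|_|; ring.
apply: (le_lt_trans (ler_normB _ _)).
apply: (le_lt_trans (lerD (inner_CauchySchwarz _ _) (inner_CauchySchwarz _ _))).
rewrite (isometry_norm iso) -mulrDr.
apply: (@le_lt_trans _ _ (`|g - f| * s)).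
  by rewrite ler_wpM2l// lerDl.
by rewrite -ltr_pdivlMr.
Qed.

Lemma adjointP (H : hilbertType R) (X : operator H) f :
  adjoint_dom X f -> is_adjoint_value X f (adjoint X f).
Proof. by rewrite /adjoint => -[h Xfh]; case: xgetP => [k _ //|/(_ h)]. Qed.

(** A sesquilinear form B that vanishes on the diagonal of a subspace vanishes:
    f + g and i f + g give B f g + B g f = 0 and B f g - B g f = 0.  Here B is
    the difference of the two sides. *)
Lemma formally_q_normal_polar (H : hilbertType R) (q : R) (X : operator H) f g :
  0 < q -> formally_q_normal q X -> dom X f -> dom X g ->
  inner (adjoint X f) (adjoint X g) = q%:C%C * inner (X f) (X g).
Proof.
move=> q0 [dX DX nX].
have adjZD a x y : dom X x -> dom X y ->
    adjoint X (a *: x + y) = a *: adjoint X x + adjoint X y.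
  move=> Dx Dy; apply: adjoint_eq => // k Dk.
  rewrite !linearDr/= !linearZr_LR/=.
  by rewrite (adjointP (DX _ Dx) Dk) (adjointP (DX _ Dy) Dk).
pose B x y := inner (adjoint X x) (adjoint X y) - q%:C%C * inner (X x) (X y).
have Bxx x : dom X x -> B x x = 0.
  move=> Dx; rewrite /B !inner_norm nX// exprMn -rmorphXn/= sqr_sqrtr ?ltW//.
  by rewrite subrr.
have BZD a x y : dom X x -> dom X y ->
    B (a *: x + y) (a *: x + y) = a * a^* * B x x + a * B x y + a^* * B y x + B y y.
  by move=> Dx Dy; rewrite /B adjZD// opZD// !(innerPl, innerPr); ring.
move=> Df Dg; apply/eqP; rewrite -subr_eq0 -/(B f g).
have E1 := BZD 1 f g Df Dg; have E2 := BZD 'i f g Df Dg.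
move: E1 E2; rewrite !Bxx//; [|exact: domZD..].
rewrite conjCi rmorph1 !mulr0 !add0r !addr0 !mul1r => E1 E2.
have E3 : 0 = 'i * (B f g - B g f) by rewrite E2; ring.
have : B f g = B g f.
  by apply/eqP; rewrite -subr_eq0; move/esym/eqP: E3; rewrite mulf_eq0 (negbTE (neq0Ci _)).
move=> Bfg; move: E1; rewrite -Bfg -mulr2n => /esym/eqP.
by rewrite mulrn_eq0.
Qed.

Lemma q_normal_formally (H : hilbertType R) (q : R) (X : operator H) :
  q_normal q X -> formally_q_normal q X.
Proof. by case=> dX DX nX; split=> //; rewrite DX. Qed.

(** In the range of iota, u = adjoint Y (iota f) acts like v = adjoint X f, so
    iota v is the orthogonal projection of u onto this range.  But both vectors
    have the norm sqrt q |X f|, and a projection that keeps the norm of u is u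
    itself. *)
Lemma extension_adjoint (H K : hilbertType R) (iota : {linear H -> K}) (q : R)
    (X : operator H) (Y : operator K) f :
  (forall f g, inner (iota f) (iota g) = inner f g) ->
  formally_q_normal q X -> formally_q_normal q Y -> operator_le iota X Y ->
  dom X f -> adjoint Y (iota f) = iota (adjoint X f).
Proof.
move=> iso [dX DX nX] [dY DY nY] XY Df.
have [Dif Yf] := XY _ Df.
pose u := adjoint Y (iota f); pose v := adjoint X f.
have uv g : inner (iota g) u = inner g v.
  apply: (dense_inner_eq (D := dom X) iso) => // {}g Dg; have [Dig Yg] := XY _ Dg.
  by rewrite -(adjointP (DY _ Dif) Dig) Yg iso (adjointP (DX _ Df) Dg).
have uu : `|u| = `|v| by rewrite /u /v nY// nX// Yf (isometry_norm iso).
have uiv : inner (u - iota v) (u - iota v) = 0.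
  rewrite innerBl !innerBr (innerC u (iota v)) (uv v) iso !inner_norm uu.
  by rewrite (geC0_conj (exprn_ge0 2 (normr_ge0 v))) !subrr.
apply/eqP; rewrite -subr_eq0 -normr_eq0 -sqrf_eq0 -inner_norm.
exact/eqP.
Qed.

(** The equality of the domains of Y and of its adjoint is what carries the
    argument: X h is seen to lie in the domain of the adjoint, and the value of
    Y there gives the bound. *)
Lemma q_normal_extension_bound (H K : hilbertType R) (iota : {linear H -> K})
    (q : R) (X : operator H) (Y : operator K) h :
  0 < q -> (forall f g, inner (iota f) (iota g) = inner f g) ->
  formally_q_normal q X -> q_normal q Y -> operator_le iota X Y ->
  dom X h -> dom X (adjoint X h) ->
  exists M : C, forall g, dom X g -> `|inner (adjoint X g) (X h)| <= M * `|g|.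
Proof.
move=> q0 iso qX qY XY Dh DXh; have fqY := q_normal_formally qY.
have adjY f (Df : dom X f) := extension_adjoint iso qX fqY XY Df.
have [dY DY nY] := qY; have [Dih Yh] := XY _ Dh; have [DiXh YXh] := XY _ DXh.
have q0' : q%:C%C != 0 by rewrite eq_complex/= eqxx andbT gt_eqF.
(* The adjoint takes iota (X h) to the vector Y (iota (adjoint X h)) / q. *)
have DYh : dom Y (iota (X h)).
  rewrite DY; exists ((q^-1)%:C%C *: Y (iota (adjoint X h))) => g Dg.
  have A : inner (adjoint Y g) (iota (adjoint X h)) = inner g (Y (iota (adjoint X h))).
    have [_ DY' _] := fqY.
    by rewrite innerC -(adjointP (DY' _ Dg) DiXh) -innerC.
  have cc : ((q^-1)%:C%C)^* = (q^-1)%:C%C :> C by rewrite geC0_conj// ler0c invr_ge0 ltW.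
  apply: (mulfI q0'); rewrite -Yh -(formally_q_normal_polar q0 fqY Dg Dih).
  by rewrite adjY// A innerZr cc mulrA -rmorphM/= mulfV ?gt_eqF// mul1r.
exists `|Y (iota (X h))| => g Dg; have [Dig Yg] := XY _ Dg.
have [_ DY' _] := fqY.
rewrite -iso -adjY// innerC -(adjointP (DY' _ Dig) DYh) norm_conjC.
by rewrite (le_trans (inner_CauchySchwarz _ _))// (isometry_norm iso).
Qed.
End HilbertFacts.

(** * Coordinate vectors, reindexings and truncations *)

Section Delta.
Context {R : realType} {I : choiceType}.
Local Notation C := R[i].
Local Notation H := (@ell2 R I).
Implicit Types (x y : H).

Lemma delta_subproof i : ((fun j => (j == i)%:R) : I -> C^o) \in square_summable.
Proof.
apply/asboolP; exists 1 => F; rewrite /psum.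
apply: (@le_trans _ _ (\sum_(j <- F) (j == i)%:R)).
  by apply: ler_sum => j _; case: eqP; rewrite /csq/= ?expr1n ?expr0n/= ?addr0.
have [iF|iF] := boolP (i \in F).
  by rewrite (big_fsetD1 i)//= eqxx big1_seq ?addr0// => j /andP[_]; rewrite !inE => /andP[/negbTE->].
rewrite big1_seq// => j /andP[_ jF]; case: eqP => // ji; by rewrite -ji jF in iF.
Qed.

Definition delta i : H := Ell2 (delta_subproof i).

Lemma deltaE i j : delta i j = (j == i)%:R. Proof. by []. Qed.

Lemma inner_delta x i : inner x (delta i) = x i.
Proof.
rewrite ell2_innerE (@ctotal_single _ _ _ i) ?deltaE ?eqxx ?rmorph1 ?mulr1// => j ji.
by rewrite deltaE (negbTE ji) rmorph0 mulr0.
Qed.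

Lemma delta_inner x i : inner (delta i) x = (x i)^*.
Proof. by rewrite innerC inner_delta. Qed.

Lemma norm_delta i : `|delta i| = 1.
Proof.
apply/eqP; rewrite -(@eqrXn2 _ 2)// -inner_norm inner_delta deltaE eqxx.
by rewrite expr1n.
Qed.

Lemma square_summable_reindex x (s t : I -> I) : cancel s t ->
  (x \o s : I -> C^o) \in square_summable.
Proof.
move=> st; have /asboolP[M xM] := coordP x; apply/asboolP; exists M => F.
by rewrite (psum_reindex (fun i => csq (x i)) F st).
Qed.

Definition ell2_reindex (s t : I -> I) (st : cancel s t) x : H :=
  Ell2 (square_summable_reindex x st).

Lemma ell2_reindexE s t (st : cancel s t) x i : ell2_reindex st x i = x (s i).
Proof. by []. Qed.

Lemma ell2_reindexZD s t (st : cancel s t) a x y :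
  ell2_reindex st (a *: x + y) =
  a *: ell2_reindex st x + ell2_reindex st y.
Proof. exact: ell2P. Qed.

Lemma ell2_reindexZ s t (st : cancel s t) a x :
  ell2_reindex st (a *: x) = a *: ell2_reindex st x.
Proof. exact: ell2P. Qed.

Lemma inner_reindex s t (st : cancel s t) (ts : cancel t s) x y :
  inner (ell2_reindex st x) y = inner x (ell2_reindex ts y).
Proof.
rewrite !ell2_innerE -[RHS](ctotal_reindex st ts); last exact: (csummable_dot x (ell2_reindex ts y)).
by congr ctotal; apply/funext => i; rewrite !ell2_reindexE /= st.
Qed.

Lemma norm_reindex s t (st : cancel s t) (ts : cancel t s) x :
  `|ell2_reindex st x| = `|x|.
Proof.
apply/eqP; rewrite -(@eqrXn2 _ 2)// -!inner_norm (inner_reindex st ts).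
have -> : ell2_reindex ts (ell2_reindex st x) = x; last by [].
by apply: ell2P => i; rewrite /= ts.
Qed.

Lemma reindex_delta s t (st : cancel s t) (ts : cancel t s) i :
  ell2_reindex st (delta i) = delta (t i).
Proof.
apply: ell2P => j.
by rewrite ell2_reindexE !deltaE (can2_eq st ts).
Qed.

Lemma truncation_subproof x (F : {fset I}) :
  ((fun i => if i \in F then x i else 0) : I -> C^o) \in square_summable.
Proof.
have /asboolP[M xM] := coordP x; apply/asboolP; exists M => G.
apply: le_trans (xM G); apply: le_psum => i; case: ifP => // _.
by rewrite [leLHS](_ : _ = 0) ?csq_ge0// /csq/= expr0n addr0.
Qed.

Definition truncation x F : H := Ell2 (truncation_subproof x F).

(** The squared norm of the remainder is the total of |x|^2 minus the partial
    sum over F. *)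
Lemma truncation_approx x (e : C) : 0 < e -> exists F, `|x - truncation x F| < e.
Proof.
move=> e0.
have [r r0 ->] : exists2 r : R, 0 < r & e = (r%:C)%C.
  by case: e e0 => a b; rewrite ltcE/= => /andP[/eqP-> a0]; exists a.
have := cvg_total (abs_summable_csq x) => /cvgrPdist_lt/(_ _ (exprn_gt0 2 r0)).
case=> F _ /(_ F (fsubset_refl F)) Fr; exists F.
rewrite ell2_normE ltcR -ltr_sqr ?nnegrE ?sqrtr_ge0 ?(ltW r0)// sqr_ell2_rnorm.
apply: le_lt_trans Fr; apply: le_trans (ler_norm _).
rewrite lerBrDr.
apply: (@le_trans _ _ (total (fun i => csq ((x - truncation x F) i)) +
                       total (fun i => csq (truncation x F i)))).
  rewrite lerD2l.
  apply: le_trans (psum_le_total F (fun i => csq_ge0 _) (abs_summable_csq _)).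
  by rewrite /psum !big_seq; apply: ler_sum => i iF /=; rewrite iF.
rewrite -totalD; [|exact: abs_summable_csq..].
rewrite le_eqVlt; apply/orP; left; apply/eqP; congr total; apply/funext => i.
rewrite coordD coordN /=; case: ifP => _; rewrite ?subrr ?subr0 /csq/=.
  by rewrite !expr0n !add0r.
by rewrite !expr0n !addr0.
Qed.
End Delta.

(** * Weighted shifts perturbed by a rank-one operator *)

Section PerturbedShift.
Context {R : realType} {I : choiceType}.
Local Notation C := R[i].
Local Notation H := (@ell2 R I).
Variables (s t : I -> I) (st : cancel s t) (ts : cancel t s).
Variables (w : I -> R) (p : R) (a b : H).
Implicit Types (x y : H).

Definition wdom x : bool := ((fun i => (w i)%:C%C * x i) : I -> C^o) \in square_summable.

Definition wmul x : H := insubd 0 ((fun i => (w i)%:C%C * x i) : I -> C^o).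

Lemma wmulE x i : wdom x -> wmul x i = (w i)%:C%C * x i.
Proof. by move=> Dx; rewrite /wmul -[LHS]/(val (insubd _ _) i) insubdK. Qed.

Lemma wdomZD c x y : wdom x -> wdom y -> wdom (c *: x + y).
Proof.
move=> Dx Dy; rewrite /wdom.
rewrite (_ : (fun i => _) = c *: ((fun i => (w i)%:C%C * x i) : I -> C^o) +
                            ((fun i => (w i)%:C%C * y i) : I -> C^o)).
  by rewrite rpredD ?rpredZ.
by apply/funext => i; rewrite coordD coordZ !fctE/= mulrDr mulrCA.
Qed.

Lemma wdom0 : wdom 0.
Proof.
rewrite /wdom (_ : (fun i => _) = 0) ?rpred0//.
by apply/funext => i; rewrite coord0 mulr0.
Qed.

Lemma wmulZD c x y : wdom x -> wdom y ->
  wmul (c *: x + y) = c *: wmul x + wmul y.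
Proof.
move=> Dx Dy; apply: ell2P => i.
by rewrite coordD coordZ !wmulE// ?wdomZD// coordD coordZ mulrDr mulrCA.
Qed.

Lemma wdom_finite x (F : {fset I}) : (forall i, i \notin F -> x i = 0) -> wdom x.
Proof.
move=> xF; apply/asboolP; pose y i : R := csq ((w i)%:C%C * x i).
exists (psum y F) => G.
apply: (@le_trans _ _ (psum y (F `|` G)%fset)).
  by apply: psum_subset; [move=> i; exact: csq_ge0|exact: fsubsetUr].
rewrite /psum (big_fsetID _ (mem F))/=.
rewrite (_ : [fset x in (F `|` G)%fset | x \in F]%fset = F); last first.
  by apply/fsetP => i; rewrite !inE/= andbC; case: (i \in F).
rewrite [X in _ + X]big1_seq ?addr0// => i /andP[_]; rewrite !inE/= => /andP[_ /xF xi].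
by rewrite /y xi mulr0 /csq/= expr0n addr0.
Qed.

Lemma wdom_delta i : wdom (delta i).
Proof.
apply: (@wdom_finite _ [fset i]%fset) => j; rewrite inE => /negbTE ji.
by rewrite deltaE ji.
Qed.

Lemma wmul_delta i : wmul (delta i) = (w i)%:C%C *: delta i.
Proof.
apply: ell2P => j; rewrite wmulE ?wdom_delta// coordZ deltaE.
by case: eqP => [->//|]; rewrite !mulr0.
Qed.

(** For a weight with w i = p * w (t i), these are the weighted shift
    delta i |-> w i delta (t i) and its adjoint.  Writing both as a permutation
    after the same multiplication operator gives them the same domain and
    proportional norms. *)
Definition lower x : H := ell2_reindex st (wmul x).
Definition raise x : H := p%:C%C *: ell2_reindex ts (wmul x).

Lemma lowerE x i : wdom x -> lower x i = (w (s i))%:C%C * x (s i).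
Proof. by move=> Dx; rewrite /lower ell2_reindexE wmulE. Qed.

Lemma lowerZD c x y : wdom x -> wdom y ->
  lower (c *: x + y) = c *: lower x + lower y.
Proof. by move=> Dx Dy; rewrite /lower wmulZD// ell2_reindexZD. Qed.

Lemma raiseZD c x y : wdom x -> wdom y ->
  raise (c *: x + y) = c *: raise x + raise y.
Proof.
move=> Dx Dy; rewrite /raise wmulZD// ell2_reindexZD scalerDr !scalerA.
by rewrite [_ * c]mulrC.
Qed.

Lemma lower_delta i : lower (delta i) = (w i)%:C%C *: delta (t i).
Proof.
by rewrite /lower wmul_delta ell2_reindexZ (reindex_delta st ts).
Qed.

Lemma raise_delta i : raise (delta i) = (p * w i)%:C%C *: delta (s i).
Proof.
rewrite /raise wmul_delta ell2_reindexZ (reindex_delta ts st).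
by rewrite scalerA -rmorphM.
Qed.

Hypothesis w_shift : forall i, w i = p * w (t i).

Lemma lower_raise x y : wdom x -> wdom y -> inner (lower x) y = inner x (raise y).
Proof.
move=> Dx Dy; rewrite (inner_reindex st ts) innerZr.
rewrite !ell2_innerE -ctotalZ; last exact: (csummable_dot x (ell2_reindex ts (wmul y))).
have conj_real (r : R) : (r%:C%C : C)^* = r%:C%C by apply: conjc_real.
congr ctotal; apply/funext => i; rewrite !ell2_reindexE !wmulE// w_shift conj_real.
by rewrite rmorphM/= rmorphM/= conj_real; ring.
Qed.

Lemma norm_raise x : 0 < p -> `|raise x| = p%:C%C * `|lower x|.
Proof.
move=> p0; rewrite normrZ !norm_reindex// ger0_norm// ler0c ltW//.
Qed.

(** Where these vanish, the rank-one corrections in shift_op and shift_adj are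
    reflections of lower x and raise x (norm_sub_half_projection). *)
Definition lower_defect x : C := inner (lower x) b - `|b| ^+ 2 / 2 * inner x a.
Definition raise_defect x : C := inner (raise x) a - `|a| ^+ 2 / 2 * inner x b.

Lemma lower_defectZD c x y : wdom x -> wdom y ->
  lower_defect (c *: x + y) = c * lower_defect x + lower_defect y.
Proof.
move=> Dx Dy; rewrite /lower_defect lowerZD// !innerPl; ring.
Qed.

Lemma raise_defectZD c x y : wdom x -> wdom y ->
  raise_defect (c *: x + y) = c * raise_defect x + raise_defect y.
Proof.
move=> Dx Dy; rewrite /raise_defect raiseZD// !innerPl; ring.
Qed.

Definition shift_dom : set H :=
  [set x | [/\ wdom x, lower_defect x = 0 & raise_defect x = 0]].

(** The corrections x |-> <x, a> b and x |-> <x, b> a are adjoint to each other,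
    so the perturbation keeps the formal adjointness of the shifts. *)
Definition shift_op x : H := lower x - inner x a *: b.
Definition shift_adj x : H := raise x - inner x b *: a.

Lemma shift_domZD c x y : shift_dom x -> shift_dom y -> shift_dom (c *: x + y).
Proof.
move=> [Dx lx rx] [Dy ly ry]; split; first exact: wdomZD.
  by rewrite lower_defectZD// lx ly mulr0 addr0.
by rewrite raise_defectZD// rx ry mulr0 addr0.
Qed.

Lemma shift_dom0 : shift_dom 0.
Proof.
have wd := wdom0; split=> //.
  by have := lower_defectZD (-1) wd wd; rewrite scaler0 addr0 mulN1r addNr.
by have := raise_defectZD (-1) wd wd; rewrite scaler0 addr0 mulN1r addNr.
Qed.

Lemma shift_opZD c x y : shift_dom x -> shift_dom y ->
  shift_op (c *: x + y) = c *: shift_op x + shift_op y.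
Proof.
move=> [Dx _ _] [Dy _ _]; rewrite /shift_op lowerZD// innerPl scalerDl.
by rewrite scalerBr scalerA opprD addrACA.
Qed.

Definition perturbed_shift : operator H :=
  Operator shift_dom0 shift_domZD shift_opZD.

Lemma perturbed_shift_adjoint_value x :
  shift_dom x -> is_adjoint_value perturbed_shift x (shift_adj x).
Proof.
move=> [Dx _ _] y [Dy _ _] /=; rewrite innerBl innerBr innerZl.
by rewrite lower_raise// (innerC b x) [inner y (_ *: a)]innerZr mulrC.
Qed.

Hypothesis p0 : 0 < p.

Lemma norm_shift_adj x : shift_dom x -> `|shift_adj x| = p%:C%C * `|shift_op x|.
Proof.
move=> [Dx lx rx]; rewrite !norm_sub_half_projection ?norm_raise//.
  exact/subr0_eq.
exact/subr0_eq.
Qed.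

Lemma perturbed_shift_adjoint x : dense shift_dom -> shift_dom x ->
  adjoint perturbed_shift x = shift_adj x.
Proof.
move=> dD Dx.
exact: (@adjoint_eq R H perturbed_shift _ _ dD (perturbed_shift_adjoint_value Dx)).
Qed.

Lemma perturbed_shift_formally_q_normal : dense shift_dom ->
  formally_q_normal (p ^+ 2) perturbed_shift.
Proof.
move=> dD; split=> //= x Dx.
  by exists (shift_adj x); apply: perturbed_shift_adjoint_value.
rewrite perturbed_shift_adjoint// norm_shift_adj//.
by rewrite sqrtr_sqr ger0_norm// ltW.
Qed.

End PerturbedShift.

(** * Density of the domain *)

Section DenseDomain.
Context {R : realType} {I : choiceType}.
Local Notation C := R[i].
Local Notation H := (@ell2 R I).
Variables (s t : I -> I) (st : cancel s t) (ts : cancel t s).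
Variables (w : I -> R) (p : R) (a b : H).
Let ld := lower_defect st w a b.
Let rd := raise_defect ts w p a b.

(** A finitely supported g close to f is moved into the domain by adding
    multiples of one coordinate vector per condition.  Up to sign, the multiples
    are the defects of g divided by those of the coordinate vectors, which are
    arbitrarily large; so the correction is small. *)
Lemma dense_shift_dom :
  (forall M : R, exists i, rd (delta i) = 0 /\ M%:C%C < `|ld (delta i)|) ->
  (forall M : R, exists i, ld (delta i) = 0 /\ M%:C%C < `|rd (delta i)|) ->
  dense (shift_dom st ts w p a b).
Proof.
move=> unbl unbr O [f Of] oO.
have [e /= e0 feO] : exists2 e : C, 0 < e & ball f e `<=` O.
  have /nbhs_ballP[e e0 fe] : nbhs f O by exact: open_nbhs_nbhs.
  by exists e.
have e2 : 0 < e / 2 by rewrite divr_gt0.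
have e4 : 0 < e / 2 / 2 by rewrite !divr_gt0.
have [F fF] := truncation_approx f e2; set g := truncation f F in fF.
have Dg : wdom w g.
  by apply: (@wdom_finite _ _ _ _ F) => i iF; rewrite /g /= (negbTE iF).
have small (z : C) (k k' : I -> C) :
    (forall M : R, exists i, k' i = 0 /\ M%:C%C < `|k i|) ->
    exists i, [/\ k' i = 0, k i != 0 & `|z / k i| < e / 2 / 2].
  move=> unb; have ze0 : 0 <= `|z| / (e / 2 / 2) by rewrite divr_ge0// ltW.
  have [i [k'i ki]] := unb (complex.Re (`|z| / (e / 2 / 2))).
  exists i; rewrite RRe_real ?ger0_real// in ki.
  have ki0 : 0 < `|k i| by apply: le_lt_trans ki.
  split=> //; first by rewrite -normr_gt0.
  by rewrite normrM normfV ltr_pdivrMr// mulrC -ltr_pdivrMr.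
have [i [rdi ldi0 li]] := small (ld g) (fun i => ld (delta i)) (fun i => rd (delta i)) unbl.
have [j [ldj rdj0 rj]] := small (rd g) (fun i => rd (delta i)) (fun i => ld (delta i)) unbr.
pose c := - (ld g / ld (delta i)); pose d := - (rd g / rd (delta j)).
pose g' := d *: delta j + (c *: delta i + g).
have Dig : wdom w (c *: delta i + g) by rewrite wdomZD ?wdom_delta.
exists g'; split; last first.
  split; first by rewrite wdomZD ?wdom_delta.
    rewrite -/(ld _) [LHS]lower_defectZD ?wdom_delta// lower_defectZD ?wdom_delta//.
    by rewrite -/(ld (delta j)) -/(ld (delta i)) -/(ld g) ldj mulr0 add0r mulNr divfK// addNr.
  rewrite -/(rd _) [LHS]raise_defectZD ?wdom_delta// raise_defectZD ?wdom_delta//.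
  by rewrite -/(rd (delta j)) -/(rd (delta i)) -/(rd g) rdi mulr0 add0r mulNr divfK// addNr.
apply: feO; rewrite -ball_normE /=.
have -> : f - g' = (f - g) - (d *: delta j + c *: delta i).
  by rewrite /g' [RHS]addrAC !opprD !addrA.
rewrite [e]splitr; apply: (le_lt_trans (ler_normB _ _)).
rewrite ltrD// [e / 2]splitr (le_lt_trans (ler_normD _ _))//.
by rewrite !normrZ !norm_delta !mulr1 !normrN ltrD.
Qed.
End DenseDomain.

Section ColumnVector.
Context {R : realType}.
Local Notation C := R[i].
Local Notation H := (@ell2 R (nat * int)%type).

(** The partial sums are at most 2 - 2 * 2^-N for a bound N on the first
    indices, since the squares 4^-m are dominated by 2^-m. *)
Lemma column_subproof (k : int) :
  ((fun i => if i.2 == k then ((2^-1 : R) ^+ i.1)%:C%C else 0) : nat * int -> C^o)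
    \in square_summable.
Proof.
set e : nat * int -> C^o := fun i => _.
apply/asboolP; exists 2 => F.
pose g j : R := ((2^-1 : R) ^+ j) ^+ 2.
have g0 j : 0 <= g j by rewrite sqr_ge0.
have [N FN] : exists N, forall i, i \in F -> (i.1 < N)%N.
  exists (\max_(i <- F) i.1).+1 => i iF; rewrite ltnS.
  by rewrite (big_fsetD1 i)//= leq_maxl.
(* Each index of F in the column k is counted once by its first component. *)
have eg i : i \in F -> csq (e i) = \sum_(j < N) (i == (val j, k))%:R * g j.
  move=> iF; rewrite /e; case: eqP => [ik|ik]; last first.
    rewrite /csq/= expr0n addr0 big1// => j _.
    by case: eqP => [ij|_]; [rewrite ij/= in ik|rewrite mul0r].
  rewrite (bigD1 (Ordinal (FN i iF)))//= -ik -surjective_pairing eqxx mul1r.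
  rewrite big1 ?addr0 /csq/= ?expr0n ?addr0// => j jn.
  case: eqP => [ij|_]; last by rewrite mul0r.
  by move/negP: jn; case; apply/eqP/val_inj; rewrite /= ij.
rewrite /psum big_seq (eq_bigr _ eg) -big_seq exchange_big/=.
apply: (@le_trans _ _ (\sum_(j < N) g j)).
  apply: ler_sum => j _; rewrite -mulr_suml ler_piMl//.
  have [iF|iF] := boolP ((val j, k) \in F).
    by rewrite (big_fsetD1 (val j, k))//= eqxx big1_seq ?addr0// => i /andP[_]; rewrite !inE => /andP[/negbTE->].
  by rewrite big1_seq// => i /andP[_ jF]; case: eqP => // ji; rewrite -ji jF in iF.
have h1 n : (2^-1 : R) ^+ n <= 1 by rewrite exprn_ile1// ?invr_ge0// invf_le1// ler1n.
have h0 n : 0 <= (2^-1 : R) ^+ n by rewrite exprn_ge0// invr_ge0.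
suff : \sum_(j < N) g j <= 2 - 2 * 2^-1 ^+ N.
  by move/le_trans; apply; rewrite gerBl mulr_ge0.
elim: N {FN eg} => [|N IH]; first by rewrite big_ord0 expr0 mulr1 subrr.
rewrite big_ord_recr/= exprS (_ : g N = (2^-1 ^+ N) ^+ 2)//.
have := h0 N; have := h1 N; move: IH.
by move: (\sum_(j < N) g j) (2^-1 ^+ N) => S y *; nra.
Qed.

Definition column k : H := Ell2 (column_subproof k).

Lemma columnE k i :
  column k i = if i.2 == k then ((2^-1 : R) ^+ i.1)%:C%C else 0.
Proof. by []. Qed.
End ColumnVector.

(** * The operator without q-normal extension *)

Section Example.
Context {R : realType}.
Variables (q : R) (q0 : 0 < q).
Local Notation C := R[i].
Local Notation I := (nat * int)%type.
Local Notation H := (@ell2 R I).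
Local Open Scope complex_scope.

Let p := Num.sqrt q.
Let p0 : 0 < p. Proof. by rewrite sqrtr_gt0. Qed.

Definition up (i : I) : I := (i.1, i.2 + 1).
Definition down (i : I) : I := (i.1, i.2 - 1).

Lemma upK : cancel up down.
Proof. by case=> m n; rewrite /up /down/= addrK. Qed.

Lemma downK : cancel down up.
Proof. by case=> m n; rewrite /up /down/= subrK. Qed.

(** The factor p^n makes the weight compatible with the shift of columns; the
    factor 4^m makes the operator unbounded inside every column, and beats the
    decay 2^-m of the columns that perturb it. *)
Definition weight (i : I) : R := 4 ^+ i.1 * p ^ i.2.

Lemma weight_down i : weight i = p * weight (down i).
Proof.
case: i => m n; rewrite /weight/= -{1}(subrK 1 n) expfzDr ?gt_eqF// expr1z; ring.
Qed.

Definition avec : H := column 1.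
Definition bvec : H := column 0.

(** The defect of the m-th coordinate vector in the column where the condition
    given by x lives; see lower_defect_delta and raise_defect_delta. *)
Definition defect (x : H) (m : nat) : R := 2 ^+ m * p - ell2_rnorm x ^+ 2 / 2 * 2^-1 ^+ m.

Lemma half_sqr_norm (x : H) : `|x| ^+ 2 / 2 = (ell2_rnorm x ^+ 2 / 2)%:C.
Proof. by rewrite ell2_normE rmorphM/= rmorphXn/= fmorphV/= rmorph_nat. Qed.

Lemma four_half m : 4 ^+ m * 2^-1 ^+ m = 2 ^+ m :> R.
Proof. by rewrite -exprMn; congr (_ ^+ _); lra. Qed.

Lemma conj_realC (r : R) : Num.conj (r%:C : C) = r%:C.
Proof. exact: conjc_real. Qed.

Lemma norm_realC (r : R) : `|r%:C : C| = `|r|%:C.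
Proof. by rewrite normc_def/= expr0n addr0 sqrtr_sqr. Qed.

Lemma lower_defect_delta m n :
  lower_defect upK weight avec bvec (delta (m, n)) =
  if n == 1 then (defect bvec m)%:C else 0.
Proof.
rewrite /lower_defect (lower_delta upK downK) innerZl !delta_inner !columnE.
rewrite /= subr_eq0 half_sqr_norm; case: eqP => [->|_]; last by rewrite rmorph0 !mulr0 subrr.
by rewrite !conj_realC -!rmorphM -rmorphB /weight/= expr1z mulrAC four_half.
Qed.

Lemma raise_defect_delta m n :
  raise_defect downK weight p avec bvec (delta (m, n)) =
  if n == 0 then (defect avec m)%:C else 0.
Proof.
rewrite /raise_defect (raise_delta upK downK) innerZl !delta_inner !columnE.
rewrite /= -(subr_eq0 (n + 1)) addrK half_sqr_norm; case: eqP => [->|_]; last by rewrite rmorph0 !mulr0 subrr.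
by rewrite !conj_realC -!rmorphM -rmorphB /weight/= expr0z mulr1 -mulrA four_half mulrC.
Qed.

Lemma defect_unbounded x (M : R) : exists m, M < `|defect x m|.
Proof.
have arith (y u v d e : R) : M <= y -> y + d < u -> u <= v -> e <= d -> M < v - e.
  by lra.
set c := ell2_rnorm x ^+ 2 / 2.
have c0 : 0 <= c by rewrite divr_ge0// sqr_ge0.
exists (Num.bound ((`|M| + c) / p)); set m := Num.bound _.
apply: lt_le_trans (ler_norm _); rewrite /defect -/c.
have : (`|M| + c) / p < m%:R.
  by apply: archi_boundP; rewrite divr_ge0// ?addr_ge0// ltW.
rewrite ltr_pdivrMr// => Mm.
have m2 : m%:R <= 2 ^+ m :> R by rewrite -natrX ler_nat ltnW// ltn_expl.
have m2p : m%:R * p <= 2 ^+ m * p by rewrite ler_pM2r.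
have c2 : c * 2^-1 ^+ m <= c.
  by rewrite ler_piMr// exprn_ile1// ?invr_ge0// invf_le1// ler1n.
exact: arith (ler_norm M) Mm m2p c2.
Qed.

Local Notation D := (shift_dom upK downK weight p avec bvec).
Definition example := perturbed_shift upK downK weight p avec bvec.

Lemma dense_example : dense D.
Proof.
apply: dense_shift_dom => M.
  have [m Mm] := defect_unbounded bvec M; exists (m, 1).
  by rewrite raise_defect_delta lower_defect_delta/= norm_realC ltcR.
have [m Mm] := defect_unbounded avec M; exists (m, 0).
by rewrite raise_defect_delta lower_defect_delta/= norm_realC ltcR.
Qed.

(** The perturbation and the two conditions only involve the columns 0 and 1. *)
Lemma delta_example_dom m n : n != 0 -> n != 1 -> D (delta (m, n)).
Proof.
move=> n0 n1; split; first exact: wdom_delta.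
  by rewrite lower_defect_delta (negbTE n1).
by rewrite raise_defect_delta (negbTE n0).
Qed.

Lemma example_formally_q_normal : formally_q_normal q example.
Proof.
rewrite -[q in formally_q_normal q _]sqr_sqrtr ?ltW//.
apply: perturbed_shift_formally_q_normal dense_example => //.
exact: weight_down.
Qed.

(** The combination of the first two coordinate vectors of the column 1 on
    which the defects cancel. *)
Definition witness : H :=
  (- (defect bvec 0)%:C) *: delta (1, 1) + (defect bvec 1)%:C *: delta (0, 1).

Let D0 : D 0. Proof. exact: shift_dom0. Qed.
Let DZ c x : D x -> D (c *: x).
Proof. by move=> Dx; rewrite -[_ *: _]addr0; apply: shift_domZD. Qed.
Let wd i : wdom weight (delta i). Proof. exact: wdom_delta. Qed.
Let wdZ c i : wdom weight (c *: delta i).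
Proof. by rewrite -[_ *: _]addr0; apply: wdomZD => //; case: D0. Qed.

Lemma witness_dom : D witness.
Proof.
have [wd0 ld0 rd0] := D0.
split; first exact: wdomZD.
  rewrite lower_defectZD// -[_ *: delta (0, 1)]addr0 lower_defectZD// ld0.
  by rewrite !lower_defect_delta/= addr0 mulNr mulrC addNr.
rewrite raise_defectZD// -[_ *: delta (0, 1)]addr0 raise_defectZD// rd0.
by rewrite !raise_defect_delta/= !mulr0 !addr0.
Qed.

Lemma witness_adj_dom : D (shift_adj downK weight p avec bvec witness).
Proof.
have [wd0 _ _] := D0.
rewrite /shift_adj innerPl innerZl !delta_inner !columnE/= rmorph0 !mulr0 addr0.
rewrite scale0r subr0 raiseZD// -[_ *: delta (0, 1)]addr0 raiseZD//.
have -> : raise downK weight p 0 = 0.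
  by have := raiseZD downK p (-1) wd0 wd0; rewrite scaler0 addr0 scaleN1r addNr.
rewrite addr0 !(raise_delta upK downK).
by apply: shift_domZD; do ?apply: DZ; apply: delta_example_dom.
Qed.

(** The terms with |b|^2 cancel, so the product is nonzero for every p > 0. *)
Lemma witness_avec : inner witness avec = (3 / 2 * p)%:C.
Proof.
rewrite innerPl innerZl !delta_inner !columnE/= !conj_realC -rmorphN -!rmorphM -rmorphD.
by congr (_%:C); rewrite /defect !expr0 !expr1 !mulr1; lra.
Qed.

Lemma witness_op_coord k : (1 < k)%N ->
  shift_op upK weight avec bvec witness (k, 0) =
  (- (3 / 2 * p * 2^-1 ^+ k))%:C.
Proof.
move=> k1; have [wdw _ _] := witness_dom.
rewrite /shift_op coordD coordN coordZ witness_avec columnE lowerE//.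
rewrite [witness _]coordD !coordZ !deltaE /up/= !xpair_eqE.
have -> : (k == 1)%N = false by apply/negbTE; rewrite neq_ltn k1 orbT.
have -> : (k == 0)%N = false by apply/negbTE; rewrite -lt0n (ltn_trans _ k1).
by rewrite !mulr0 addr0 mulr0 add0r -rmorphM -rmorphN.
Qed.

Lemma example_adj_delta k :
  shift_adj downK weight p avec bvec (delta (k, -1)) = (4 ^+ k)%:C *: delta (k, 0).
Proof.
rewrite /shift_adj (raise_delta upK downK) delta_inner columnE/= rmorph0.
by rewrite scale0r subr0 /weight/= mulrCA exprN1 mulfV ?gt_eqF// mulr1.
Qed.

(** The vector 4^k delta (k, 0) meets the component of example witness along b,
    whose k-th entry only decays like 2^-k. *)
Lemma example_unbounded (M : C) :
  exists2 g, D g & ~~ (`|inner (adjoint example g) (example witness)| <= M * `|g|).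
Proof.
have p32 : 0 < 3 / 2 * p by rewrite mulr_gt0.
have [k Mk] : exists k, complex.Re M < 3 / 2 * p * 2 ^+ k.+2.
  exists (Num.bound (`|complex.Re M| / (3 / 2 * p))); set k := Num.bound _.
  rewrite mulrC -ltr_pdivrMr//.
  have Mk : complex.Re M / (3 / 2 * p) <= `|complex.Re M| / (3 / 2 * p).
    by rewrite ler_pM2r ?invr_gt0// ler_norm.
  apply: (le_lt_trans Mk); apply: (@lt_le_trans _ _ k%:R).
    by apply: archi_boundP; rewrite divr_ge0// ltW.
  by rewrite -natrX ler_nat (leq_trans _ (ltnW (ltn_expl _ _)))// ltnW.
have Dg : D (delta (k.+2, -1)) by apply: delta_example_dom.
exists (delta (k.+2, -1)) => //.
rewrite /example (perturbed_shift_adjoint weight_down dense_example Dg).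
rewrite example_adj_delta norm_delta mulr1 innerZl delta_inner witness_op_coord//.
rewrite conj_realC -rmorphM norm_realC mulrN normrN mulrCA four_half.
rewrite gtr0_norm; last by rewrite mulr_gt0 ?exprn_gt0.
by case: M Mk => x y /= xk; rewrite lecE/= negb_and -ltNge xk orbT.
Qed.
End Example.

Theorem theorem5 (R : realType) (q : R) (hq : 0 < q) :
  exists (H : hilbertType R) (X : operator H),
    formally_q_normal q X /\
    ~ (exists (K : hilbertType R) (iota : {linear H -> K}) (Y : operator K),
         [/\ closed_subspace iota, q_normal q Y & operator_le iota X Y]).
Proof.
exists (@ell2 R (nat * int)%type), (example q).
have qX := example_formally_q_normal hq; split=> // -[K [iota [Y [[iso _] qY XY]]]].
have Dw := witness_dom q.
have DXw : dom (example q) (adjoint (example q) (witness q)).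
  rewrite /example (perturbed_shift_adjoint (weight_down hq) (dense_example hq) Dw).
  exact: witness_adj_dom.
have [M XM] := q_normal_extension_bound hq iso qX qY XY Dw DXw.
by have [g Dg /negP[]] := example_unbounded hq M; apply: XM.
Qed.
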